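(* Let $f$ be a monic polynomial of degree $n \ge 2$ with simple complex zeros. Let $1 \le p \le \infty$ and $1/p + 1/q = 1$. Define the real function $$\phi(x) = \frac{(n - 1)^{1/q}\, x}{(1 - x)(1 - 2^{1/q} x)} \left(1 + \frac{x}{(n - 1)^{1/p} (1 - 2^{1/q} x)} \right)^{n - 1}.$$ Suppose that $z^0$ is an initial point in $\mathbb{C}^n$ with distinct coordinates satisfying $$E(z^0) < 1/2^{1/q} \quad\text{and}\quad \phi(E(z^0)) \le 1 .$$ Then the following statements hold true. 1. The Weierstrass iterative sequence $z^{k+1} = z^k - W(z^k)$, $k = 0,1,2,\ldots$, starting from $z^0$, is well-defined and convergent to a root-vector $\xi$ of $f$. Moreover, the convergence is quadratic if $\phi(E(z^0)) < 1$. 2. For each $k \ge 1$ we have the a priori error estimate $$\left\| z^k - \xi \right\|_p \le \frac{\theta^k \lambda^{2^k - 1}}{1 - \theta \lambda^{2^k}} \left\| z^1 - z^0 \right\|_p ,$$ where $\lambda = \phi(E(z^0))$ and $\theta = 1 - 2^{1/q} E(z^0)$. 3. For all $k \ge 0$ we have the a posteriori error estimate $$\left\| z^{k + 1} - \xi \right\|_p \le \frac{\theta_k \lambda_k}{1 - \theta_k \lambda_k^2} \left\| z^{k + 1} - z^k \right\|_p ,$$ where $\lambda_k = \phi(E(z^k))$ and $\theta_k = 1 - 2^{1/q} E(z^k)$.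
   Context: For a monic polynomial $f$ of degree $n \ge 2$ and $z = (z_1,\ldots,z_n) \in \mathbb{C}^n$ with distinct coordinates, define $W(z) = (W_1(z), \ldots, W_n(z))$ by $$W_i(z) = \frac{f(z_i)}{\prod_{j \ne i}(z_i - z_j)}, \qquad i = 1,\ldots,n.$$ The Weierstrass iterative sequence starting from $z^0 \in \mathbb{C}^n$ with distinct coordinates is $z^{k+1} = z^k - W(z^k)$, $k = 0,1,2,\ldots$ (here $z^k$ denotes the $k$-th iterate, not a power; the operator $W$ is defined only at points with distinct coordinates). A root-vector of $f$ is a point $\xi \in \mathbb{C}^n$ with distinct coordinates each of which is a zero of $f$. The norm on $\mathbb{C}^n$ is the usual $\|z\|_p = \left(\sum_{i=1}^n |z_i|^p\right)^{1/p}$ for $1\le p<\infty$ and $\|z\|_\infty = \max_i |z_i|$; the convention $1/\infty = 0$ is used in $1/p+1/q=1$ and in exponents. For $z \in \mathbb{C}^n$ with distinct coordinates put $$d_i(z) = \min_{j \ne i} |z_i - z_j|, \qquad \frac{W(z)}{d(z)} = \left(\frac{W_1(z)}{d_1(z)}, \ldots, \frac{W_n(z)}{d_n(z)}\right), \qquad E(z) = \left\| \frac{W(z)}{d(z)} \right\|_p .$$ *)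

(* Defs.v *)
From mathcomp Require Import all_boot all_order all_algebra.
From mathcomp Require Import complex.
From mathcomp Require Import all_classical all_reals all_analysis.

Set Implicit Arguments.
Unset Strict Implicit.
Unset Printing Implicit Defensive.

Import Order.TTheory GRing.Theory Num.Theory.
Import numFieldNormedType.Exports.

Local Open Scope classical_set_scope.
Local Open Scope ring_scope.
Local Open Scope complex_scope.

(* The modulus [`|z|] of the library lives in [R[i]]; this is the R-valued one. *)
Definition cabs (R : realType) (z : R[i]) : R := ComplexField.Normc.normc z.

(* The exponent 1/p, with 1/oo = 0 since +oo^-1 = 0 in \bar R. *)
Definition inv_exp (R : realType) (p : \bar R) : R := fine (p^-1)%E.

(* Meant for 1 <= p <= +oo. *)
Definition pnorm (R : realType) (p : \bar R) (n : nat) (z : 'rV[R[i]]_n) : R :=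
  match p with
  | r%:E => (\sum_(i < n) cabs (z ord0 i) `^ r) `^ (1 / r)
  | _ => \big[Num.max/0]_(i < n) cabs (z ord0 i)
  end.

Definition distinct_coords (R : realType) (n : nat) (z : 'rV[R[i]]_n) : Prop :=
  injective (fun i : 'I_n => z ord0 i).

Definition root_vector (R : realType) (n : nat) (f : {poly R[i]})
    (xi : 'rV[R[i]]_n) : Prop :=
  distinct_coords xi /\ forall i : 'I_n, root f (xi ord0 i).

Definition simple_zeros (R : realType) (f : {poly R[i]}) : Prop :=
  forall x : R[i], root f x -> mup x f = 1%N.

(* When coordinates coincide this is a junk value (x / 0 = 0). *)
Definition weierstrass (R : realType) (n : nat) (f : {poly R[i]})
    (z : 'rV[R[i]]_n) : 'rV[R[i]]_n :=
  \row_(i < n) (f.[z ord0 i] / \prod_(j < n | j != i) (z ord0 i - z ord0 j)).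

(* As the correction is total, well-definedness of the iteration means that
   every term of this sequence has distinct coordinates. *)
Definition weierstrass_seq (R : realType) (n : nat) (f : {poly R[i]})
    (z0 : 'rV[R[i]]_n) (k : nat) : 'rV[R[i]]_n :=
  iter k (fun z => z - weierstrass f z) z0.

(* +oo is only the neutral element of min; it is never the value when n >= 2. *)
Definition min_dist (R : realType) (n : nat) (z : 'rV[R[i]]_n) (i : 'I_n) : R :=
  fine (\big[Order.min/+oo%E]_(j < n | j != i)
          (cabs (z ord0 i - z ord0 j))%:E).

Definition Wd_norm (R : realType) (n : nat) (p : \bar R) (f : {poly R[i]})
    (z : 'rV[R[i]]_n) : R :=
  pnorm p (\row_(i < n) (weierstrass f z ord0 i / (min_dist z i)%:C)).

Definition phi (R : realType) (n : nat) (p q : \bar R) (x : R) : R :=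
  n.-1%:R `^ inv_exp q * x / ((1 - x) * (1 - 2 `^ inv_exp q * x)) *
  (1 + x / (n.-1%:R `^ inv_exp p * (1 - 2 `^ inv_exp q * x))) ^+ n.-1.

Definition converges_to (R : realType) (n : nat) (p : \bar R)
    (z : nat -> 'rV[R[i]]_n) (xi : 'rV[R[i]]_n) : Prop :=
  pnorm p (z k - xi) @[k --> \oo] --> (0 : R).

Definition converges_quadratically (R : realType) (n : nat) (p : \bar R)
    (z : nat -> 'rV[R[i]]_n) (xi : 'rV[R[i]]_n) : Prop :=
  converges_to p z xi /\
  exists C : R, forall k : nat,
    pnorm p (z k.+1 - xi) <= C * pnorm p (z k - xi) ^+ 2.

(* Main.v *)
Require Import Defs.
From mathcomp Require Import all_boot all_order all_algebra.
From mathcomp Require Import complex.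
From mathcomp Require Import all_classical all_reals all_analysis.
From mathcomp Require Import ring lra.
Import Order.TTheory GRing.Theory Num.Theory.
Import numFieldNormedType.Exports.
Local Open Scope classical_set_scope.
Local Open Scope ring_scope.
Local Open Scope complex_scope.

Set Implicit Arguments.
Unset Strict Implicit.
Unset Printing Implicit Defensive.

(** Write [W] for the vector of corrections of [z], [w_i = |W_i| / d_i(z)], and
    [z' = z - W].  The whole proof rests on what one step does to [W].

    Since [f] is monic of degree [n], Lagrange interpolation at the coordinates of
    [z] gives [f(x) = prod_j (x - z_j) + sum_j W_j prod_(k != j) (x - z_k)]
    ([weierstrass_lagrange]).  At [x = z'_i] the term of index [i] cancels the
    full product, and the other terms contain the factor [z'_i - z_i = - W_i].
    Hence
    [W_i(z') = - W_i * sum_(j != i) W_j / (z'_i - z_j)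
                     * prod_(j != i) (z'_i - z_j) / (z'_i - z'_j)].
    Hoelder's inequality bounds the sum of any [m] of the [w_j] by
    [m^(1/q) E(z)].  With [m = 2], no distance between coordinates shrinks by more
    than the factor [theta = 1 - 2^(1/q) E(z)] ([weierstrass_step_gap]).  With
    [m = n - 1], the sum above is at most [(n-1)^(1/q) E / (1 - E)], and the
    product is controlled through the inequality between arithmetic and geometric
    means.  Together
    [|W_i(z')| <= theta * phi(E(z)) * |W_i|] ([weierstrass_step_correction]) and
    [E(z') <= phi(E(z)) * E(z)] ([weierstrass_step_Wd_norm]).

    Because [phi(x) / x] is nondecreasing, the last inequality gives
    [lambda_(k+1) <= lambda_k^2] for [lambda_k = phi(E(z^k))].  Multiplying the
    one-step bounds yields
    [|W_i(z^k)| <= theta^k lambda^(2^k - 1) |W_i(z^0)|]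
    ([weierstrass_seq_correction]), and summing the remaining steps gives the
    a priori estimate coordinate by coordinate ([weierstrass_a_priori]).  The
    a posteriori estimate is the same estimate for the sequence restarted at
    [z^k].

    Letting [k] tend to infinity in the Lagrange formula at [z^k] shows
    [f = prod_j (X - xi_j)] for the limit [xi]
    ([weierstrass_limit_factorization]), and then the simplicity of the zeros
    makes the coordinates of [xi] distinct.  So the distances between coordinates
    of [z^k] stay away from zero, [W(z^k)] and [E(z^k)] are of the order of the
    error, and the a posteriori estimate turns into a quadratic one
    ([weierstrass_quadratic]). *)

(** * The complex modulus *)

Section Modulus.
Variable R : realType.
Implicit Types x y : R[i].

Lemma cabs_ge0 x : 0 <= cabs x.
Proof. by case: x => a b; rewrite /cabs /= sqrtr_ge0. Qed.

Lemma cabs0 : cabs (0 : R[i]) = 0. Proof. exact: ComplexField.Normc.normc0. Qed.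

Lemma cabs0_eq0 x : cabs x = 0 -> x = 0.
Proof. exact: ComplexField.Normc.eq0_normc. Qed.

Lemma cabs_gt0 x : (0 < cabs x) = (x != 0).
Proof.
rewrite lt_def cabs_ge0 andbT; congr (~~ _); apply/eqP/eqP => [/cabs0_eq0//|->].
exact: cabs0.
Qed.

Lemma cabsM x y : cabs (x * y) = cabs x * cabs y.
Proof. exact: ComplexField.Normc.normcM. Qed.

Lemma cabsV x : cabs x^-1 = (cabs x)^-1.
Proof. exact: ComplexField.Normc.normcV. Qed.

Lemma cabsD x y : cabs (x + y) <= cabs x + cabs y.
Proof. exact: le_normcD. Qed.

Lemma cabsN x : cabs (- x) = cabs x.
Proof. exact: normcN. Qed.

Lemma cabs_distC x y : cabs (x - y) = cabs (y - x).
Proof. by rewrite -cabsN opprB. Qed.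

Lemma cabs_real (r : R) : 0 <= r -> cabs (r%:C) = r.
Proof. by move=> r0; rewrite /cabs /= expr0n addr0 sqrtr_sqr ger0_norm. Qed.

Lemma cabs_prod (I : Type) (s : seq I) (P : pred I) (F : I -> R[i]) :
  cabs (\prod_(i <- s | P i) F i) = \prod_(i <- s | P i) cabs (F i).
Proof. by apply: (big_morph _ cabsM); exact: ComplexField.Normc.normc1. Qed.

Lemma cabs_sum (I : Type) (s : seq I) (P : pred I) (F : I -> R[i]) :
  cabs (\sum_(i <- s | P i) F i) <= \sum_(i <- s | P i) cabs (F i).
Proof.
apply: (big_ind2 (fun x r => cabs x <= r)) => // [|x r y s' xr ys].
  by rewrite cabs0.
exact: le_trans (cabsD _ _) (lerD xr ys).
Qed.

Lemma cabsB_ge x y : cabs x - cabs y <= cabs (x - y).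
Proof. by rewrite lerBlDr -{1}(subrK y x) cabsD. Qed.

Lemma Re_le_cabs x : `|complex.Re x| <= cabs x.
Proof.
case: x => a b; rewrite /cabs /= -sqrtr_sqr ler_wsqrtr // lerDl sqr_ge0 //.
Qed.

Lemma Im_le_cabs x : `|complex.Im x| <= cabs x.
Proof.
by case: x => a b; rewrite /cabs /= -sqrtr_sqr ler_wsqrtr // lerDr sqr_ge0.
Qed.

Lemma cabs_le_ReIm x : cabs x <= `|complex.Re x| + `|complex.Im x|.
Proof.
case: x => a b; rewrite /cabs /= -[leRHS]ger0_norm ?addr_ge0 //.
rewrite -sqrtr_sqr ler_wsqrtr // sqrrD !real_normK ?num_real // lerD2r lerDl.
by rewrite mulrn_wge0 // mulr_ge0.
Qed.

End Modulus.

(** * The p-norm and Hoelder's inequality *)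

Section PNorm.
Variable R : realType.
Implicit Types p q : \bar R.

Lemma invr_powR (x s : R) : 0 <= x -> x^-1 `^ s = (x `^ s)^-1.
Proof. by move=> x0; rewrite -powR_inv1 // powRAC powR_inv1 // powR_ge0. Qed.

Lemma inv_exp_conj p q : (1 <= p)%E -> (p^-1 + q^-1 = 1)%E ->
  [/\ 0 <= inv_exp p, 0 <= inv_exp q & inv_exp p + inv_exp q = 1].
Proof.
move=> p1 pq.
have pV0 : (0 <= p^-1)%E by rewrite inve_ge0 (le_trans _ p1).
have pV1 : (p^-1 <= 1)%E.
  case: p p1 {pq pV0} => [r||//]; last by rewrite invey.
  rewrite inver lee_fin => r1; have r0 : 0 < r by exact: lt_le_trans r1.
  by rewrite gt_eqF // lee_fin invf_le1.
rewrite /inv_exp.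
case: (p^-1)%E pV0 pV1 pq => [u||//]; last by [].
rewrite !lee_fin => u0 u1.
case: (q^-1)%E => [v||//] // [uv] /=; split => //; lra.
Qed.

Lemma pnorm_ge0 p n (z : 'rV[R[i]]_n) : 0 <= pnorm p z.
Proof.
case: p => [r||] /=; first exact: powR_ge0.
- exact: bigmax_ge_id.
- exact: bigmax_ge_id.
Qed.

(** The norm estimates of the iteration are obtained from coordinatewise ones
    through this lemma, which spares Minkowski's inequality. *)
Lemma pnorm_le p n (c : R) (x y : 'rV[R[i]]_n) : (1 <= p)%E -> 0 <= c ->
  (forall i, cabs (x ord0 i) <= c * cabs (y ord0 i)) ->
  pnorm p x <= c * pnorm p y.
Proof.
case: p => [r||//] /= p1 c0 xy; last first.
  apply: bigmax_le => [|i _]; first by rewrite mulr_ge0 // bigmax_ge_id.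
  apply: le_trans (xy i) _; rewrite ler_wpM2l //.
  by rewrite (le_bigmax _ (fun i => cabs (y ord0 i))).
move: p1; rewrite lee_fin => r1.
have r0 : 0 < r by exact: lt_le_trans r1.
have s0 (z : 'rV[R[i]]_n) : 0 <= \sum_(i < n) cabs (z ord0 i) `^ r.
  by rewrite sumr_ge0 // => i _; rewrite powR_ge0.
have -> : c = (c `^ r) `^ (1 / r) by rewrite -powRrM mul1r divff ?gt_eqF // powRr1.
rewrite -powRM ?powR_ge0 // ge0_ler_powR ?nnegrE ?divr_ge0 ?mulr_ge0 ?powR_ge0 //.
  by rewrite ltW.
rewrite mulr_sumr ler_sum // => i _; rewrite -powRM ?cabs_ge0 //.
by rewrite ge0_ler_powR ?nnegrE ?mulr_ge0 ?cabs_ge0 // ltW.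
Qed.

(** This is Hoelder's inequality against the indicator function of [A].  For
    [1 < p < oo], the coordinates are normalised so that their [p]-norm is one, and
    Young's inequality is summed against the constant [#|A|^(-1/q)]. *)
Lemma sum_cabs_le_pnorm p q n (A : {pred 'I_n}) (z : 'rV[R[i]]_n) :
  (1 <= p)%E -> (p^-1 + q^-1 = 1)%E ->
  \sum_(i in A) cabs (z ord0 i) <= #|A|%:R `^ inv_exp q * pnorm p z.
Proof.
move=> p1 pq; have [ip0 iq0 ipq] := inv_exp_conj p1 pq.
have [A0|Agt0] := posnP #|A|.
  rewrite big_pred0; last by move=> i; exact: card0_eq A0 i.
  by rewrite mulr_ge0 ?powR_ge0 ?pnorm_ge0.
case: p p1 ip0 ipq {pq} => [r||//] p1 ip0 ipq; last first.
  have -> : inv_exp q = 1 by move: ipq; rewrite /inv_exp invey /= add0r.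
  rewrite powRr1 ?ler0n // mulr_natl -sumr_const ler_sum // => i _.
  by rewrite /= (le_bigmax _ (fun i => cabs (z ord0 i))).
move: p1; rewrite lee_fin => r1; have r0 : 0 < r by exact: lt_le_trans r1.
have ipr : inv_exp r%:E = r^-1 by rewrite /inv_exp inver gt_eqF.
rewrite ipr in ip0 ipq.
have s0 (P : pred 'I_n) : 0 <= \sum_(i | P i) cabs (z ord0 i) `^ r.
  by rewrite sumr_ge0 // => i _; rewrite powR_ge0.
have sub : \sum_(i in A) cabs (z ord0 i) `^ r <= \sum_i cabs (z ord0 i) `^ r.
  rewrite [leRHS](bigID (mem A)) /= lerDl sumr_ge0 // => i _.
  exact: powR_ge0.
move: r1; rewrite le_eqVlt => /predU1P[r1|r1].
  have -> : inv_exp q = 0 by move: ipq; rewrite -r1 invr1; lra.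
  rewrite powRr0 mul1r /= -r1 divr1 powRr1; last by move: (s0 xpredT); rewrite -r1.
  rewrite -r1 in sub; apply: le_trans (_ : _ <= \sum_(i in A) cabs (z ord0 i) `^ 1) sub.
  by rewrite ler_sum // => i _; rewrite powRr1 ?cabs_ge0.
set N := pnorm _ z.
have N0 : 0 <= N := pnorm_ge0 _ _.
have Nr : N `^ r = \sum_i cabs (z ord0 i) `^ r.
  by rewrite /N /= -powRrM mul1r mulVf ?gt_eqF // powRr1 // s0.
set m := #|A|%:R; have m0 : 0 < m :> R by rewrite ltr0n.
set t := inv_exp q in iq0 ipq *.
have rV1 : r^-1 < 1 by rewrite invf_lt1.
have t0 : 0 < t by lra.
(* A vector of norm zero cannot be normalised, but all its coordinates vanish. *)
move: N0; rewrite le_eqVlt => /predU1P[N0|N0].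
  rewrite -N0 mulr0 big1 // => i _; apply/eqP.
  have /eqP : \sum_i cabs (z ord0 i) `^ r = 0 by rewrite -Nr -N0 powR0 // gt_eqF.
  rewrite psumr_eq0 => [|j _]; last exact: powR_ge0.
  by move/allP/(_ i (mem_index_enum i)); rewrite powR_eq0 => /andP[].
have mt0 : 0 < m `^ t by exact: powR_gt0.
rewrite -ler_pdivrMr // -[leRHS]mul1r -ler_pdivrMr // !mulr_suml.
apply: le_trans
  (_ : _ <= \sum_(i in A) ((cabs (z ord0 i) `^ r / N `^ r) / r + m^-1 * t)) _.
  apply: ler_sum => i _.
  have := @conjugate_powR R (cabs (z ord0 i) / N) (m `^ t)^-1 r t^-1.
  rewrite invrK; move=> /(_ _ _ _ _ _)/le_trans; apply => //.
  - by rewrite divr_ge0 ?cabs_ge0 // ltW.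
  - by rewrite invr_ge0 ltW.
  - by rewrite invr_gt0.
  rewrite powRM ?cabs_ge0 ?invr_ge0 ?(ltW N0) // !invr_powR ?(ltW N0) ?(ltW mt0) //.
  by rewrite -powRrM divff ?gt_eqF // powRr1 // ltW.
rewrite big_split /= -!mulr_suml sumr_const -[m^-1 *+ _]mulr_natl -/m divff ?gt_eqF //.
have : (\sum_(i in A) cabs (z ord0 i) `^ r) / N `^ r <= 1.
  by rewrite ler_pdivrMr ?mul1r; [rewrite Nr | exact: powR_gt0].
move=> /(ler_wpM2r ip0); lra.
Qed.

End PNorm.

(** * Distances between coordinates *)

Section MinDist.
Variables (R : realType) (n : nat).
Implicit Types z : 'rV[R[i]]_n.

Lemma min_dist_attained z i : (2 <= n)%N ->
  exists2 j, j != i & min_dist z i = cabs (z ord0 i - z ord0 j).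
Proof.
move=> n2; have [j0 j0i] : exists j : 'I_n, j != i.
  have : (0 < #|predC1 i|)%N by rewrite cardC1 card_ord; case: n n2 => [|[]].
  by move=> /card_gt0P[j]; exists j.
have [|j ji ej] := @eq_bigmin _ _ _ +oo%E j0 (fun j => j != i)
    (fun j => (cabs (z ord0 i - z ord0 j))%:E) j0i _.
  by move=> *; exact: leey.
by exists j => //; rewrite /min_dist ej.
Qed.

Lemma min_dist_le z i j : j != i -> min_dist z i <= cabs (z ord0 i - z ord0 j).
Proof.
move=> ji; rewrite /min_dist -lee_fin fineK; last first.
  have [|k _ ->//] := @eq_bigmin _ _ _ +oo%E j (fun j => j != i)
    (fun j => (cabs (z ord0 i - z ord0 j))%:E) ji _.
  by move=> *; exact: leey.
exact: (@bigmin_le_cond _ _ _ +oo%E j (fun j => j != i)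
    (fun j => (cabs (z ord0 i - z ord0 j))%:E)).
Qed.

Lemma min_dist_gt0 z i : (2 <= n)%N -> distinct_coords z -> 0 < min_dist z i.
Proof.
move=> n2 dz; have [j ji ->] := min_dist_attained z i n2.
by rewrite cabs_gt0 subr_eq0; apply: contra_neq ji => /dz.
Qed.

End MinDist.

(** * Lagrange interpolation at the iterate *)

Section Lagrange.
Variables (R : realType) (n : nat) (f : {poly R[i]}).
Hypotheses (f_monic : f \is monic) (f_deg : size f = n.+1).

Lemma horner_prodXsubC (P : pred 'I_n) (u : 'I_n -> R[i]) (x : R[i]) :
  (\prod_(j | P j) ('X - (u j)%:P)).[x] = \prod_(j | P j) (x - u j).
Proof. by rewrite horner_prod; apply: eq_bigr => j _; rewrite hornerXsubC. Qed.

(** The corrections [W_j] are the Lagrange coefficients of [f - prod_j (X - z_j)],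
    which has degree less than [n] because [f] is monic of degree [n]. *)
Lemma weierstrass_lagrange (z : 'rV[R[i]]_n) : distinct_coords z ->
  f = \prod_j ('X - (z ord0 j)%:P) +
      \sum_j weierstrass f z ord0 j *: \prod_(k | k != j) ('X - (z ord0 k)%:P).
Proof.
move=> dz; apply/eqP; rewrite -subr_eq0; apply/eqP.
pose rs := [seq z ord0 i | i : 'I_n].
have rs_size : size rs = n by rewrite size_map -cardE card_ord.
apply: (@roots_geq_poly_eq0 _ _ rs).
(* At z_i only the i-th Lagrange term survives, with value f(z_i). *)
- apply/allP => _ /mapP[i _ ->].
  rewrite rootE hornerD hornerN hornerD horner_sum horner_prodXsubC.
  rewrite (bigD1 i) //= subrr mul0r add0r.
  rewrite (bigD1 i) //= [X in _ - (_ + X)]big1 => [|j ji]; last first.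
    by rewrite hornerZ horner_prodXsubC (bigD1 i) 1?eq_sym //= subrr mul0r mulr0.
  rewrite addr0 hornerZ horner_prodXsubC mxE.
  rewrite divfK ?subrr //; apply/prodf_neq0 => j ji.
  by rewrite subr_eq0 eq_sym; apply: contra_neq ji => /dz.
- by rewrite map_inj_uniq ?enum_uniq //; exact: dz.
(* The leading terms of f and of the monic product of degree n cancel, and each
   Lagrange term has degree n - 1. *)
rewrite rs_size opprD addrA; apply: leq_trans (size_polyD _ _) _.
rewrite geq_max; apply/andP; split.
  rewrite -ltnS -f_deg.
  have P_size : size (\prod_j ('X - (z ord0 j)%:P)) = n.+1.
    by rewrite -big_enum /= size_prod_XsubC size_enum_ord.
  have P_monic : \prod_j ('X - (z ord0 j)%:P) \is monic.
    by rewrite monic_prod_XsubC.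
  rewrite f_deg; apply/leq_sizeP => m.
  rewrite leq_eqVlt => /predU1P[<-|nm].
    rewrite coefB; move/monicP: f_monic; move/monicP: P_monic.
    by rewrite /lead_coef f_deg P_size /= => -> ->; rewrite subrr.
  by rewrite coefB !nth_default ?subrr ?f_deg ?P_size.
rewrite size_polyN; apply: leq_trans (size_sum _ _ _) _.
apply/bigmax_leqP => j _; apply: leq_trans (size_scale_leq _ _) _.
rewrite size_prod => [|k _]; last by rewrite polyXsubC_eq0.
under eq_bigr do rewrite size_XsubC.
rewrite sum_nat_const cardC1 card_ord muln2.
by case: (n) j => [[]//|m] _ /=; rewrite -addnn -addSn addnK.
Qed.

(** At [x = z_i - W_i] the [i]-th Lagrange term cancels against the full product,
    so the new residual keeps [W_i] as a factor and is of second order in [W]. *)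
Lemma horner_weierstrass_step (z : 'rV[R[i]]_n) (i : 'I_n) :
  distinct_coords z ->
  let x := z ord0 i - weierstrass f z ord0 i in
  (forall j, j != i -> x != z ord0 j) ->
  f.[x] = - weierstrass f z ord0 i * \prod_(j | j != i) (x - z ord0 j) *
          \sum_(j | j != i) weierstrass f z ord0 j / (x - z ord0 j).
Proof.
move=> dz x xz; rewrite {1}(weierstrass_lagrange dz).
rewrite hornerD horner_sum horner_prodXsubC.
rewrite (bigD1 i) //= [X in _ + X](bigD1 i) //= hornerZ horner_prodXsubC.
have xi : x - z ord0 i = - weierstrass f z ord0 i.
  by rewrite /x addrAC subrr sub0r.
rewrite {1}xi mulNr addrA addNr add0r mulNr -mulrN -sumrN mulr_sumr.
apply: eq_bigr => j ji; rewrite hornerZ horner_prodXsubC.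
rewrite (bigD1 i) 1?eq_sym //= (bigD1 (P := fun k => k != i) j) //= xi.
under eq_bigl do rewrite andbC.
have := xz j ji; rewrite -subr_eq0; move: (\prod_(_ | _) _) => P xj.
by field.
Qed.

End Lagrange.

(** * The real functions that control one step *)

Section ScalarFunctions.
Variables (R : realType) (n : nat) (p q : \bar R).
Implicit Types x y t : R.

(** The factor by which one step shrinks, at worst, the distance between two
    coordinates. *)
Definition gap_factor x : R := 1 - 2 `^ inv_exp q * x.

(** The factor by which one step multiplies, at worst, the modulus of each
    correction [W_i]; its quotient by [gap_factor] is [phi], which therefore
    bounds the growth of the ratios [W_i / d_i]. *)
Definition correction_factor x : R :=
  n.-1%:R `^ inv_exp q * (x / (1 - x)) *
  (1 + x / (n.-1%:R `^ inv_exp p * gap_factor x)) ^+ n.-1.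

Hypotheses (n2 : (2 <= n)%N) (hp : (1 <= p)%E) (hpq : (p^-1 + q^-1 = 1)%E).

Lemma gap_factor_gt0_lt1 x : 0 <= x -> 0 < gap_factor x -> x < 1.
Proof.
move=> x0; rewrite subr_gt0; apply: le_lt_trans.
have [_ iq0 _] := inv_exp_conj hp hpq.
by rewrite ler_peMl // -{1}(powRr0 2) ler_powR // ler1n.
Qed.

Lemma le_gap_factor x y : y <= x -> gap_factor x <= gap_factor y.
Proof. by move=> yx; rewrite lerB // ler_wpM2l // powR_ge0. Qed.

Lemma predn_gt0 : 0 < n.-1%:R :> R.
Proof. by rewrite ltr0n; case: n n2 => [|[]]. Qed.

Lemma powR_predn_conj :
  n.-1%:R `^ inv_exp q * n.-1%:R `^ inv_exp p = n.-1%:R :> R.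
Proof.
have [_ _ ipq] := inv_exp_conj hp hpq.
rewrite -powRD ?(gt_eqF predn_gt0) ?implybT // addrC ipq powRr1 //.
Qed.

Lemma phi_correction_factor x :
  phi n p q x = correction_factor x / gap_factor x.
Proof.
rewrite /phi /correction_factor -/(gap_factor x).
by rewrite invfM !mulrA [LHS]mulrAC.
Qed.

Let mean_factor_ge0 x : 0 <= x -> 0 < gap_factor x ->
  0 <= x / (n.-1%:R `^ inv_exp p * gap_factor x).
Proof. by move=> x0 gx; rewrite divr_ge0 // mulr_ge0 ?powR_ge0 // ltW. Qed.

Lemma correction_factor_ge0 x :
  0 <= x -> 0 < gap_factor x -> 0 <= correction_factor x.
Proof.
move=> x0 gx; have x1 := gap_factor_gt0_lt1 x0 gx.
rewrite !mulr_ge0 ?powR_ge0 ?invr_ge0 ?subr_ge0 ?(ltW x1) //.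
by rewrite exprn_ge0 // addr_ge0 // mean_factor_ge0.
Qed.

Lemma phi_ge0 x : 0 <= x -> 0 < gap_factor x -> 0 <= phi n p q x.
Proof.
by move=> x0 gx; rewrite phi_correction_factor divr_ge0 ?correction_factor_ge0 // ltW.
Qed.

(** [correction_factor] is [x] times a nondecreasing function, so it shrinks at
    least as fast as its argument. *)
Lemma correction_factor_scale x y t : 0 <= x -> 0 <= y -> 0 <= t <= 1 -> y <= t * x ->
  0 < gap_factor x -> correction_factor y <= t * correction_factor x.
Proof.
move=> x0 y0 /andP[t0 t1] ytx gx.
have yx : y <= x by rewrite (le_trans ytx) // ler_piMl.
have x1 := gap_factor_gt0_lt1 x0 gx.
have gy := lt_le_trans gx (le_gap_factor yx).
have y1 := le_lt_trans yx x1.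
rewrite /correction_factor !mulrA [t * _]mulrC -!mulrA.
rewrite ler_wpM2l ?powR_ge0 // !mulrA ler_pM //.
- by rewrite divr_ge0 // subr_ge0 ltW.
- by rewrite exprn_ge0 // addr_ge0 // mean_factor_ge0.
- rewrite ler_pM // ?invr_ge0 ?subr_ge0 ?(ltW y1) //.
  by rewrite lef_pV2 ?posrE ?subr_gt0 // lerB.
rewrite lerXn2r ?nnegrE ?addr_ge0 ?mean_factor_ge0 // lerD2l.
have c0 : 0 < n.-1%:R `^ inv_exp p by rewrite powR_gt0 // predn_gt0.
rewrite ler_pM ?invr_ge0 ?mulr_ge0 ?powR_ge0 ?(ltW gy) //.
by rewrite lef_pV2 ?posrE ?mulr_gt0 // ler_pM2l // le_gap_factor.
Qed.

Lemma phi_scale x y t : 0 <= x -> 0 <= y -> 0 <= t <= 1 -> y <= t * x ->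
  0 < gap_factor x -> phi n p q y <= t * phi n p q x.
Proof.
move=> x0 y0 t01 ytx gx; have /andP[_ t1] := t01.
have yx : y <= x by rewrite (le_trans ytx) // ler_piMl.
have gy := lt_le_trans gx (le_gap_factor yx).
rewrite !phi_correction_factor mulrA ler_pM ?invr_ge0 ?(ltW gy) //.
- exact: correction_factor_ge0.
- exact: correction_factor_scale.
- by rewrite lef_pV2 ?posrE // le_gap_factor.
Qed.

End ScalarFunctions.

(** * One step of the iteration *)

Section OneStep.
Variables (R : realType) (n : nat) (f : {poly R[i]}) (p q : \bar R).
Variable z : 'rV[R[i]]_n.
Hypotheses (n2 : (2 <= n)%N) (f_monic : f \is monic) (f_deg : size f = n.+1).
Hypotheses (hp : (1 <= p)%E) (hpq : (p^-1 + q^-1 = 1)%E).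
Hypothesis dz : distinct_coords z.
Let W := weierstrass f z.
Let E := Wd_norm p f z.
Hypothesis hE : 0 < gap_factor q E.

Let w i := cabs (W ord0 i) / min_dist z i.
Let z' := z - W.

Let E_ge0 : 0 <= E. Proof. exact: pnorm_ge0. Qed.

Let E_lt1 : E < 1.
Proof. exact: gap_factor_gt0_lt1 hp hpq _ E_ge0 hE. Qed.

Let w_ge0 i : 0 <= w i.
Proof. by rewrite divr_ge0 ?cabs_ge0 // ltW // min_dist_gt0. Qed.

Let sum_w_le (A : {pred 'I_n}) : \sum_(i in A) w i <= #|A|%:R `^ inv_exp q * E.
Proof.
apply: le_trans (sum_cabs_le_pnorm A _ hp hpq); apply: ler_sum => i _.
by rewrite mxE cabsM cabsV cabs_real // ltW // min_dist_gt0.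
Qed.

Let w_leE i : w i <= E.
Proof.
by have := sum_w_le (pred1 i); rewrite big_pred1_eq card1 powR1 mul1r.
Qed.

Let w_pair_le i j : j != i -> w i + w j <= 2 `^ inv_exp q * E.
Proof.
move=> ji; have := sum_w_le (mem [set i; j]%SET).
by rewrite big_setU1 ?big_set1 ?inE 1?eq_sym //= cards2 eq_sym ji.
Qed.

Let correction_le i j : j != i ->
  cabs (W ord0 i) <= w i * cabs (z ord0 i - z ord0 j).
Proof.
move=> ji; rewrite -[leLHS](divfK (lt0r_neq0 (min_dist_gt0 i n2 dz))).
by rewrite ler_wpM2l ?w_ge0 // min_dist_le.
Qed.

Let z'E i : z' ord0 i = z ord0 i - W ord0 i. Proof. by rewrite !mxE. Qed.

(** Two corrections can bring [z_i] and [z_j] closer by at most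
    [(w_i + w_j) * |z_i - z_j|], and Hoelder's inequality for two terms bounds
    [w_i + w_j] by [2^(1/q) * E]. *)
Lemma weierstrass_step_gap i j : j != i ->
  gap_factor q E * cabs (z ord0 i - z ord0 j) <= cabs (z' ord0 i - z' ord0 j).
Proof.
move=> ji; have ij : i != j by rewrite eq_sym.
have -> : z' ord0 i - z' ord0 j =
    (z ord0 i - z ord0 j) - (W ord0 i - W ord0 j) by rewrite !z'E; ring.
apply: le_trans (cabsB_ge _ _); rewrite mulrBl mul1r lerD2l lerN2.
apply: le_trans (cabsD _ _) _; rewrite cabsN.
apply: le_trans (lerD (correction_le ji) (correction_le ij)) _.
by rewrite [cabs (z ord0 j - _)]cabs_distC -mulrDl ler_wpM2r ?cabs_ge0 ?w_pair_le.
Qed.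

Lemma weierstrass_step_distinct : distinct_coords z'.
Proof.
move=> i j /= zij; apply/eqP; rewrite eq_sym; apply/negPn/negP => ji.
have := weierstrass_step_gap ji; rewrite zij subrr cabs0 leNgt mulr_gt0 //.
by rewrite cabs_gt0 subr_eq0; apply: contra_neq ji => /dz.
Qed.

Let dist_old_ge i j : j != i ->
  (1 - E) * cabs (z ord0 i - z ord0 j) <= cabs (z' ord0 i - z ord0 j).
Proof.
move=> ji; rewrite z'E addrAC; apply: le_trans (cabsB_ge _ _).
rewrite mulrBl mul1r lerD2l lerN2.
by apply: le_trans (correction_le ji) _; rewrite ler_wpM2r ?cabs_ge0 ?w_leE.
Qed.

Let dist_gt0 i j : j != i -> 0 < cabs (z ord0 i - z ord0 j).
Proof. by move=> ji; rewrite cabs_gt0 subr_eq0; apply: contra_neq ji => /dz. Qed.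

Let dist_old_gt0 i j : j != i -> 0 < cabs (z' ord0 i - z ord0 j).
Proof.
by move=> ji; apply: lt_le_trans (dist_old_ge ji); rewrite mulr_gt0 ?subr_gt0 ?dist_gt0.
Qed.

Let dist_new_gt0 i j : j != i -> 0 < cabs (z' ord0 i - z' ord0 j).
Proof.
by move=> ji; apply: lt_le_trans (weierstrass_step_gap ji); rewrite mulr_gt0 ?dist_gt0.
Qed.

Let sum_corrections_le i :
  cabs (\sum_(j | j != i) W ord0 j / (z' ord0 i - z ord0 j)) <=
  n.-1%:R `^ inv_exp q * (E / (1 - E)).
Proof.
apply: le_trans (cabs_sum _ _ _) _.
apply: le_trans (_ : _ <= \sum_(j | j != i) w j / (1 - E)) _.
  apply: ler_sum => j ji; rewrite cabsM cabsV.
  rewrite -mulrA ler_wpM2l ?cabs_ge0 // -invfM lef_pV2 ?posrE ?dist_old_gt0 //.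
    rewrite mulrC; apply: le_trans (dist_old_ge ji).
    rewrite ler_wpM2l ?subr_ge0 ?(ltW E_lt1) // cabs_distC min_dist_le //.
    by rewrite eq_sym.
  by rewrite mulr_gt0 ?subr_gt0 ?min_dist_gt0.
rewrite -mulr_suml mulrA ler_wpM2r ?invr_ge0 ?subr_ge0 ?(ltW E_lt1) //.
by have := sum_w_le (predC1 i); rewrite cardC1 card_ord.
Qed.

(** The arithmetic-geometric mean inequality turns the product over [j] into a
    power of the mean of the [w_j], which Hoelder's inequality bounds. *)
Let prod_ratio_le i :
  \prod_(j | j != i) (cabs (z' ord0 i - z ord0 j) / cabs (z' ord0 i - z' ord0 j))
  <= (1 + E / (n.-1%:R `^ inv_exp p * gap_factor q E)) ^+ n.-1.
Proof.
apply: le_trans (_ : _ <= \prod_(j in predC1 i) (1 + w j / gap_factor q E)) _.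
  apply: ler_prod => j ji; rewrite divr_ge0 ?cabs_ge0 //=.
  rewrite ler_pdivrMr ?dist_new_gt0 // mulrDl mul1r.
  have -> : z' ord0 i - z ord0 j = (z' ord0 i - z' ord0 j) + - W ord0 j.
    by rewrite !z'E; ring.
  apply: le_trans (cabsD _ _) _; rewrite cabsN lerD2l.
  have ij : i != j by rewrite eq_sym.
  apply: le_trans (correction_le ij) _; rewrite -[leRHS]mulrA ler_wpM2l // cabs_distC.
  by rewrite mulrC ler_pdivlMr // mulrC weierstrass_step_gap.
have w1_ge0 j : 0 <= 1 + w j / gap_factor q E.
  by rewrite addr_ge0 // divr_ge0 // ltW.
have [AGM _] := @leif_AGM R _ (predC1 i) (fun j => 1 + w j / gap_factor q E)
  (fun j _ => w1_ge0 j).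
apply: le_trans AGM _; rewrite cardC1 card_ord lerXn2r ?nnegrE //.
- by rewrite divr_ge0 ?ler0n // sumr_ge0.
- by rewrite addr_ge0 // divr_ge0 // mulr_ge0 ?powR_ge0 // ltW.
have m0 := predn_gt0 R n2.
rewrite big_split /= sumr_const cardC1 card_ord -mulr_suml mulrDl divff ?gt_eqF //.
rewrite lerD2l ler_pdivrMr // ler_pdivrMr //.
apply: le_trans (sum_w_le (predC1 i)) _; rewrite cardC1 card_ord.
(* The mean E (n-1)^(1/q) / (n-1) is E / (n-1)^(1/p). *)
rewrite -{3}(powR_predn_conj n2 hp hpq) le_eqVlt; apply/orP; left; apply/eqP.
have c0 : n.-1%:R `^ inv_exp p != 0 :> R by rewrite gt_eqF // powR_gt0.
have g0 : gap_factor q E != 0 by rewrite gt_eqF.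
by field; rewrite c0 g0.
Qed.

(** The residual at the new point carries [W_i] times a sum that is small with
    [E]; the denominators change from [z'_i - z_j] to [z'_i - z'_j], which costs
    the last factor of [correction_factor]. *)
Lemma weierstrass_step_correction i :
  cabs (weierstrass f z' ord0 i) <= correction_factor n p q E * cabs (W ord0 i).
Proof.
rewrite mxE cabsM cabsV.
have -> : f.[z' ord0 i] = f.[z ord0 i - W ord0 i] by rewrite z'E.
rewrite horner_weierstrass_step // => [|j ji]; last first.
  by rewrite -subr_eq0 -cabs_gt0 -/W -z'E dist_old_gt0.
rewrite -/W -z'E !cabsM !cabs_prod cabsN.
set S := cabs (\sum_(_ | _) _); set P := \prod_(_ | _) _; set Q := \prod_(_ | _) _.
have -> : cabs (W ord0 i) * P * S / Q = S * (P / Q) * cabs (W ord0 i) by ring.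
rewrite ler_wpM2r ?cabs_ge0 // ler_pM ?cabs_ge0 //.
- by rewrite divr_ge0 // prodr_ge0 // => j _; rewrite cabs_ge0.
- exact: sum_corrections_le.
by rewrite -prodf_div prod_ratio_le.
Qed.

Lemma weierstrass_step_Wd_norm : Wd_norm p f z' <= phi n p q E * E.
Proof.
apply: pnorm_le => // [|i]; first exact: phi_ge0.
have d0 := min_dist_gt0 i n2 dz.
have [j ji dj] := min_dist_attained z' i n2.
rewrite mxE [X in _ <= _ * cabs X]mxE !cabsM !cabsV.
rewrite !cabs_real ?(ltW d0) //; last by rewrite dj cabs_ge0.
rewrite phi_correction_factor mulf_div ler_pM ?cabs_ge0 ?invr_ge0 //.
- by rewrite dj cabs_ge0.
- exact: weierstrass_step_correction.
rewrite lef_pV2 ?posrE ?mulr_gt0 ?dj ?dist_new_gt0 //.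
apply: le_trans (weierstrass_step_gap ji).
by rewrite ler_wpM2l ?(ltW hE) // min_dist_le.
Qed.

End OneStep.

(** * Convergence of complex sequences *)

Section ComplexSequences.
Variable R : realType.
Implicit Types (u v : nat -> R[i]) (l m : R[i]).

(** Convergence is expressed through the real-valued modulus, so that limits are
    only ever taken in the complete space [R]. *)
Definition ccvg u l : Prop := cabs (u k - l) @[k --> \oo] --> (0 : R).

Lemma cvg0_le (r s : nat -> R) : s k @[k --> \oo] --> (0 : R) ->
  (forall k, 0 <= r k <= s k) -> r k @[k --> \oo] --> (0 : R).
Proof.
move=> s0 rs; apply: (squeeze_cvgr _ (cvg_cst 0) s0).
by apply: nearW => k; exact: rs.
Qed.

Lemma ccvg_cst l : ccvg (fun=> l) l.
Proof. by rewrite /ccvg subrr cabs0; exact: cvg_cst. Qed.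

Lemma ccvgD u v l m : ccvg u l -> ccvg v m -> ccvg (fun k => u k + v k) (l + m).
Proof.
move=> ul vm.
have uv0 : cabs (u k - l) + cabs (v k - m) @[k --> \oo] --> (0 : R).
  by rewrite -[X in _ --> X]addr0; exact: cvgD.
apply: (cvg0_le uv0) => k.
by rewrite cabs_ge0 /= opprD addrACA cabsD.
Qed.

Lemma ccvgN u l : ccvg u l -> ccvg (fun k => - u k) (- l).
Proof.
move=> ul; apply: (cvg0_le ul) => k.
by rewrite cabs_ge0 -opprD cabsN /=.
Qed.

Lemma ccvgB u v l m : ccvg u l -> ccvg v m -> ccvg (fun k => u k - v k) (l - m).
Proof. by move=> ul /ccvgN; exact: ccvgD. Qed.

Lemma ccvgM u v l m : ccvg u l -> ccvg v m -> ccvg (fun k => u k * v k) (l * m).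
Proof.
move=> ul vm.
have uv0 : cabs (u k - l) * cabs (v k - m) + cabs (u k - l) * cabs m +
    cabs l * cabs (v k - m) @[k --> \oo] --> (0 : R).
  have -> : 0 = 0 * 0 + 0 * cabs m + cabs l * 0 :> R by ring.
  apply: cvgD; last by apply: cvgM => //; exact: cvg_cst.
  by apply: cvgD; apply: cvgM => //; exact: cvg_cst.
apply: (cvg0_le uv0) => k; rewrite cabs_ge0 /=.
have -> : u k * v k - l * m =
  (u k - l) * (v k - m) + (u k - l) * m + l * (v k - m) by ring.
by rewrite -!cabsM (le_trans (cabsD _ _)) // lerD2r cabsD.
Qed.

Lemma ccvg_sum (I : Type) (s : seq I) (P : pred I) (F : I -> nat -> R[i])
    (G : I -> R[i]) : (forall i, ccvg (F i) (G i)) ->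
  ccvg (fun k => \sum_(i <- s | P i) F i k) (\sum_(i <- s | P i) G i).
Proof.
move=> FG; elim: s => [|i s IHs].
  by under [X in ccvg X]eq_fun do rewrite big_nil; rewrite big_nil; exact: ccvg_cst.
under [X in ccvg X]eq_fun do rewrite big_cons; rewrite big_cons.
by case: ifP => // _; exact: ccvgD.
Qed.

Lemma ccvg_prod (I : Type) (s : seq I) (P : pred I) (F : I -> nat -> R[i])
    (G : I -> R[i]) : (forall i, ccvg (F i) (G i)) ->
  ccvg (fun k => \prod_(i <- s | P i) F i k) (\prod_(i <- s | P i) G i).
Proof.
move=> FG; elim: s => [|i s IHs].
  by under [X in ccvg X]eq_fun do rewrite big_nil; rewrite big_nil; exact: ccvg_cst.
under [X in ccvg X]eq_fun do rewrite big_cons; rewrite big_cons.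
by case: ifP => // _; exact: ccvgM.
Qed.

Lemma ccvg_unique u l m : ccvg u l -> ccvg u m -> l = m.
Proof.
move=> ul um; apply/eqP; rewrite -subr_eq0; apply/eqP/cabs0_eq0.
have := ccvgB um ul; under [X in ccvg X]eq_fun do rewrite subrr.
by rewrite /ccvg sub0r opprB => /(cvg_unique (@norm_hausdorff _ R) (cvg_cst _)).
Qed.

Lemma ccvg_cabs u l : ccvg u l -> cabs (u k) @[k --> \oo] --> cabs l.
Proof.
move=> ul; apply/subr_cvg0/norm_cvg0P; apply: (cvg0_le ul) => k.
by rewrite normr_ge0 /= ler_norml cabsB_ge andbT lerNl opprB cabs_distC cabsB_ge.
Qed.

Lemma ccvg_shift u l d : ccvg u l -> ccvg (fun k => u (d + k)%N) l.
Proof. by move=> ul; apply: (cvg_comp _ _ (cvg_addnl d) ul). Qed.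

Lemma cvg_geometric_steps (v : nat -> R) (A r : R) : 0 <= A -> 0 <= r < 1 ->
  (forall k, `|v k.+1 - v k| <= A * r ^+ k) -> cvgn v.
Proof.
move=> A0 /andP[r0 r1] vA.
rewrite (_ : v = (fun k => v 0%N + series (telescope v) k)); last first.
  by apply/funext => k; exact: eq_sum_telescope.
apply: is_cvgD; first exact: is_cvg_cst.
apply: normed_cvg; apply: (@series_le_cvg _ _ (geometric A r)) => [k|k|k|].
- exact: normr_ge0.
- by rewrite /= mulr_ge0 // exprn_ge0.
- exact: vA.
by apply: is_cvg_geometric_series; rewrite ger0_norm.
Qed.

Lemma ccvg_geometric_steps u (A r : R) : 0 <= A -> 0 <= r < 1 ->
  (forall k, cabs (u k.+1 - u k) <= A * r ^+ k) -> exists l, ccvg u l.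
Proof.
move=> A0 r01 uA.
have re : cvgn (fun k => complex.Re (u k)).
  apply: cvg_geometric_steps A0 r01 _ => k; apply: le_trans (uA k).
  by rewrite -raddfB; exact: Re_le_cabs.
have im : cvgn (fun k => complex.Im (u k)).
  apply: cvg_geometric_steps A0 r01 _ => k; apply: le_trans (uA k).
  by rewrite -raddfB; exact: Im_le_cabs.
move: re im => /cvg_ex[a ua] /cvg_ex[b ub]; exists (Complex a b).
have ua0 : `|complex.Re (u k) - a| @[k --> \oo] --> (0 : R).
  exact/norm_cvg0P/subr_cvg0.
have ub0 : `|complex.Im (u k) - b| @[k --> \oo] --> (0 : R).
  exact/norm_cvg0P/subr_cvg0.
have ab0 : `|complex.Re (u k) - a| + `|complex.Im (u k) - b| @[k --> \oo] --> (0 : R).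
  by rewrite -[X in _ --> X]addr0; exact: cvgD.
apply: (cvg0_le ab0) => k; rewrite cabs_ge0 /=.
by apply: le_trans (cabs_le_ReIm _) _; rewrite !raddfB.
Qed.

(** The distance to the limit is at most the sum of all the remaining steps. *)
Lemma ccvg_geometric_error u l (A r : R) : 0 <= A -> 0 <= r < 1 ->
  (forall k, cabs (u k.+1 - u k) <= A * r ^+ k) -> ccvg u l ->
  cabs (u 0%N - l) <= A / (1 - r).
Proof.
move=> A0 /andP[r0 r1] uA ul.
have rV : 0 < 1 - r by rewrite subr_gt0.
have partial k : cabs (u 0%N - u k) <= A * (1 - r ^+ k) / (1 - r).
  elim: k => [|k IHk]; first by rewrite subrr cabs0 expr0 subrr mulr0 mul0r.
  have -> : u 0%N - u k.+1 = (u 0%N - u k) - (u k.+1 - u k) by ring.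
  apply: le_trans (cabsD _ _) _; rewrite cabsN.
  apply: le_trans (lerD IHk (uA k)) _.
  rewrite le_eqVlt; apply/orP; left; apply/eqP; rewrite exprS.
  by field; rewrite gt_eqF.
have lim : A / (1 - r) + cabs (u k - l) @[k --> \oo] --> A / (1 - r).
  by rewrite -[X in _ --> X]addr0; apply: cvgD => //; exact: cvg_cst.
apply: (ler_cvg_to (cvg_cst _) lim); apply: nearW => k /=.
have -> : u 0%N - l = (u 0%N - u k) + (u k - l) by ring.
apply: le_trans (cabsD _ _) _; rewrite lerD2r.
apply: le_trans (partial k) _; rewrite ler_wpM2r ?invr_ge0 ?(ltW rV) //.
by rewrite ler_piMr // gerBl exprn_ge0.
Qed.

Lemma cvg_uniform_bound (I : finType) (v : I -> nat -> R) :
  (forall i, cvgn (v i)) -> exists2 M, 0 <= M & forall i k, v i k <= M.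
Proof.
move=> vcvg.
have /choice[M vM] : forall i, exists M, forall k, v i k <= M.
  move=> i; have [M [_ Mb]] := cvg_seq_bounded (vcvg i).
  exists (M + 1) => k; apply: le_trans (ler_norm _) _.
  by apply: (Mb (M + 1)); rewrite ?ltrDl.
exists (\sum_i `|M i|) => [|i k]; first exact: sumr_ge0.
apply: le_trans (vM i k) _; apply: le_trans (ler_norm _) _.
by rewrite (bigD1 i) //= lerDl sumr_ge0.
Qed.

End ComplexSequences.

(** * Polynomials with prescribed roots *)

(** The natural numbers supply more common points than the degree allows. *)
Lemma poly_ext (R : numDomainType) (f g : {poly R}) :
  (forall x, f.[x] = g.[x]) -> f = g.
Proof.
move=> fg; apply/eqP; rewrite -subr_eq0; apply/eqP.
apply: (@roots_geq_poly_eq0 _ _ [seq k%:R | k <- iota 0 (size (f - g))]).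
- by apply/allP => x _; rewrite rootE hornerD hornerN fg subrr.
- by rewrite map_inj_uniq ?iota_uniq // => i j /eqP; rewrite eqr_nat => /eqP.
by rewrite size_map size_iota.
Qed.

(** Two equal coordinates would contribute a double zero. *)
Lemma simple_zeros_distinct (R : realType) n (xi : 'rV[R[i]]_n) :
  simple_zeros (\prod_i ('X - (xi ord0 i)%:P)) -> distinct_coords xi.
Proof.
move=> simple i j /= xij; apply/eqP/negPn/negP => ij.
have ji : j != i by rewrite eq_sym.
set f := \prod_i _ in simple.
have f2 : f = ('X - (xi ord0 i)%:P) ^+ 2 *
    \prod_(k | (k != i) && (k != j)) ('X - (xi ord0 k)%:P).
  by rewrite /f (bigD1 i) //= (bigD1 j) //= -xij mulrA -expr2.
have f0 : f != 0 by rewrite monic_neq0 // monic_prod_XsubC.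
have := simple (xi ord0 i); rewrite rootE f2 hornerM horner_exp hornerXsubC subrr.
rewrite expr0n mul0r => /(_ (eqxx _)) mu1.
have := mup_geq (xi ord0 i) 2 f0; rewrite -f2 in mu1; rewrite mu1.
by rewrite f2 dvdp_mulr // dvdpp.
Qed.

(** * The iteration and its error estimates *)

Section Iteration.
Variables (R : realType) (n : nat) (f : {poly R[i]}) (p q : \bar R).
Hypotheses (n2 : (2 <= n)%N) (f_monic : f \is monic) (f_deg : size f = n.+1).
Hypotheses (hp : (1 <= p)%E) (hpq : (p^-1 + q^-1 = 1)%E).
Implicit Types z xi : 'rV[R[i]]_n.

Local Notation E z := (Wd_norm p f z).
Local Notation theta z := (gap_factor q (E z)).
Local Notation lambda z := (phi n p q (E z)).
Local Notation W z := (weierstrass f z).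
Local Notation Z z k := (weierstrass_seq f z k).

Definition initial_condition z : Prop :=
  [/\ distinct_coords z, 0 < theta z & lambda z <= 1].

Let E_ge0 z : 0 <= E z. Proof. exact: pnorm_ge0. Qed.

Let lambda_ge0 z : initial_condition z -> 0 <= lambda z.
Proof. by case=> _ gz _; exact: phi_ge0. Qed.

Let correction_factorE z : initial_condition z ->
  correction_factor n p q (E z) = theta z * lambda z.
Proof.
by case=> _ gz _; rewrite phi_correction_factor [RHS]mulrC divfK // gt_eqF.
Qed.

(** The hypotheses on the initial point are invariant: as [lambda z <= 1], a step
    does not increase [E], and both [phi] and [gap_factor] are monotone in [E]. *)
Lemma initial_condition_step z :
  initial_condition z -> initial_condition (z - W z).
Proof.
move=> iz; have [dz gz lz] := iz; have l0 := lambda_ge0 iz.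
have Ez' : E (z - W z) <= lambda z * E z by exact: weierstrass_step_Wd_norm.
split.
- exact: (weierstrass_step_distinct n2 hp hpq dz gz).
- apply: lt_le_trans gz _; apply: le_gap_factor.
  by rewrite (le_trans Ez') // ler_piMl.
have l01 : 0 <= lambda z <= 1 by rewrite l0.
apply: le_trans (phi_scale n2 hp hpq (E_ge0 z) (E_ge0 _) l01 Ez' gz) _.
by rewrite mulr_ile1.
Qed.

Lemma initial_condition_seq z k : initial_condition z -> initial_condition (Z z k).
Proof. by move=> iz; elim: k => //= k; exact: initial_condition_step. Qed.

Let exp_range (x : R) m : 0 <= x <= 1 -> 0 <= x ^+ m <= 1.
Proof. by move=> /andP[x0 x1]; rewrite exprn_ge0 // exprn_ile1. Qed.

(** Since [phi] shrinks at least linearly, [E z' <= lambda z * E z] squares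
    [lambda] at each step; hence the exponents [2 ^ k - 1]. *)
Lemma Wd_norm_seq z k : initial_condition z ->
  E (Z z k) <= lambda z ^+ (2 ^ k - 1) * E z.
Proof.
move=> iz; have [_ gz lz] := iz; have l01 : 0 <= lambda z <= 1 by rewrite lambda_ge0.
elim: k => [|k IHk]; first by rewrite expr0 mul1r.
have [dk gk _] := initial_condition_seq k iz.
have l0 := lambda_ge0 (initial_condition_seq k iz).
apply: le_trans (weierstrass_step_Wd_norm n2 f_monic f_deg hp hpq dk gk) _.
have lk := phi_scale n2 hp hpq (E_ge0 z) (E_ge0 _) (exp_range _ l01) IHk gz.
apply: le_trans (ler_pM l0 (E_ge0 _) lk IHk) _.
rewrite -exprSr mulrA -exprD -addn1 subnK ?expn_gt0 //.
by rewrite expnS mul2n -addnn addnBA ?expn_gt0.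
Qed.

(** [correction_factor] at the [j]-th iterate is at most
    [theta z * lambda z ^+ (2 ^ j)]; the product of these bounds for [j < k] has the
    exponents [k] and [2 ^ k - 1]. *)
Lemma weierstrass_seq_correction z k i : initial_condition z ->
  cabs (W (Z z k) ord0 i) <=
  theta z ^+ k * lambda z ^+ (2 ^ k - 1) * cabs (W z ord0 i).
Proof.
move=> iz; have [_ gz lz] := iz; have l01 : 0 <= lambda z <= 1 by rewrite lambda_ge0.
elim: k => [|k IHk]; first by rewrite !expr0 !mul1r.
have ik := initial_condition_seq k iz; have [dk gk _] := ik.
apply: le_trans (weierstrass_step_correction n2 f_monic f_deg hp hpq dk gk i) _.
have ck := correction_factor_scale n2 hp hpq (E_ge0 z) (E_ge0 _) (exp_range _ l01)
  (Wd_norm_seq k iz) gz.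
have c0 : 0 <= correction_factor n p q (E (Z z k)).
  exact: correction_factor_ge0.
apply: le_trans (ler_pM c0 (cabs_ge0 _) ck IHk) _; rewrite (correction_factorE iz).
have -> : (2 ^ k.+1 - 1 = (2 ^ k - 1) + 1 + (2 ^ k - 1))%N.
  by rewrite subnK ?expn_gt0 // expnS mul2n -addnn addnBA ?expn_gt0.
rewrite !exprD expr1 exprS le_eqVlt; apply/orP; left; apply/eqP; ring.
Qed.

(** If [E z = 0] then [lambda z = 0]; otherwise [theta z < 1].  Hence the ratio
    stays below one even when [lambda z = 1]. *)
Lemma rate_range z m : initial_condition z -> (0 < m)%N ->
  0 <= theta z * lambda z ^+ m < 1.
Proof.
move=> iz m0; have [_ gz lz] := iz; have l0 := lambda_ge0 iz.
rewrite mulr_ge0 ?exprn_ge0 ?(ltW gz) //=.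
have := E_ge0 z; rewrite le_eqVlt => /predU1P[E0|E0].
  by rewrite -E0 /phi !mulr0 !mul0r expr0n gtn_eqF // mulr0.
apply: le_lt_trans (_ : _ <= theta z) _.
  by rewrite ler_piMr ?(ltW gz) // exprn_ile1.
by rewrite gtrBl mulr_gt0 // powR_gt0.
Qed.

Lemma weierstrass_seqS z k i :
  Z z k.+1 ord0 i - Z z k ord0 i = - W (Z z k) ord0 i.
Proof.
have -> : Z z k.+1 = Z z k - W (Z z k) by [].
by rewrite [X in X - _]mxE [X in _ + X - _]mxE addrC addKr.
Qed.

Lemma weierstrass_seqD z k m : Z (Z z k) m = Z z (k + m).
Proof. by rewrite /weierstrass_seq -iterD addnC. Qed.

(** From the [k]-th iterate on, the steps decay geometrically: the exponent
    [2 ^ (k + m) - 1] is at least [2 ^ k - 1 + 2 ^ k * m]. *)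
Let seq_step_le z k m i : initial_condition z ->
  cabs (Z z (k + m).+1 ord0 i - Z z (k + m) ord0 i) <=
  theta z ^+ k * lambda z ^+ (2 ^ k - 1) * cabs (W z ord0 i) *
  (theta z * lambda z ^+ (2 ^ k)) ^+ m.
Proof.
move=> iz; have [_ gz lz] := iz; have l0 := lambda_ge0 iz.
rewrite weierstrass_seqS cabsN.
apply: le_trans (weierstrass_seq_correction (k + m) i iz) _.
rewrite [leRHS]mulrAC ler_wpM2r ?cabs_ge0 // exprD [(theta z * _) ^+ m]exprMn -exprM.
rewrite -!mulrA ler_wpM2l ?exprn_ge0 ?(ltW gz) // [leRHS]mulrCA.
rewrite ler_wpM2l ?exprn_ge0 ?(ltW gz) // -exprD ler_wiXn2l //.
rewrite addnC addnBA ?expn_gt0 // leq_sub2r // -mulnSr expnD leq_mul2l.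
by rewrite ltn_expl ?orbT.
Qed.

Lemma weierstrass_seq_ccvg z : initial_condition z ->
  exists xi, forall i, ccvg (fun k => Z z k ord0 i) (xi ord0 i).
Proof.
move=> iz; have l01 := rate_range iz (ltn0Sn 0).
have /choice[x xZ] : forall i, exists x, ccvg (fun k => Z z k ord0 i) x.
  move=> i; apply: (ccvg_geometric_steps (cabs_ge0 (W z ord0 i)) l01) => k.
  by have := seq_step_le 0 k i iz; rewrite !expr0 !mul1r.
by exists (\row_i x i) => i; rewrite mxE.
Qed.

(** The Lagrange formula passes to the limit: the corrections vanish, leaving
    [f = prod_j (X - xi_j)]. *)
Lemma weierstrass_limit_factorization z xi : initial_condition z ->
  (forall i, ccvg (fun k => Z z k ord0 i) (xi ord0 i)) ->
  f = \prod_i ('X - (xi ord0 i)%:P).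
Proof.
move=> iz Zxi; apply: poly_ext => x.
apply: ccvg_unique (ccvg_cst f.[x]) _; rewrite horner_prodXsubC.
have cvg_diff j : ccvg (fun k => x - Z z k ord0 j) (x - xi ord0 j).
  by apply: ccvgB (Zxi j); exact: ccvg_cst.
have W0 j : ccvg (fun k => W (Z z k) ord0 j) 0.
  rewrite -(subrr (xi ord0 j)).
  under [X in ccvg X]eq_fun do rewrite -[_ ord0 j]opprK -weierstrass_seqS opprB.
  apply: ccvgB (Zxi j) _.
  exact: (ccvg_shift 1 (Zxi j)).
have fZ k : f.[x] = \prod_j (x - Z z k ord0 j) +
    \sum_j W (Z z k) ord0 j * \prod_(l | l != j) (x - Z z k ord0 l).
  have [dk _ _] := initial_condition_seq k iz.
  rewrite {1}(weierstrass_lagrange f_monic f_deg dk) hornerD horner_sum.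
  rewrite horner_prodXsubC; congr (_ + _); apply: eq_bigr => j _.
  by rewrite hornerZ horner_prodXsubC.
rewrite [X in ccvg X](_ : _ = fun k => \prod_j (x - Z z k ord0 j) +
    \sum_j W (Z z k) ord0 j * \prod_(l | l != j) (x - Z z k ord0 l)); last first.
  by apply/funext => k; exact: fZ.
have -> : \prod_j (x - xi ord0 j) = \prod_j (x - xi ord0 j) +
    \sum_j 0 * \prod_(l | l != j) (x - xi ord0 l).
  by rewrite [X in _ = _ + X]big1 ?addr0 // => j _; rewrite mul0r.
apply: ccvgD; first by apply: ccvg_prod => j; exact: cvg_diff.
apply: ccvg_sum => j; apply: ccvgM (W0 j) _.
by apply: ccvg_prod => l; exact: cvg_diff.
Qed.

Section Limit.
Variables z xi : 'rV[R[i]]_n.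
Hypothesis iz : initial_condition z.
Hypothesis Zxi : forall i, ccvg (fun k => Z z k ord0 i) (xi ord0 i).

Lemma weierstrass_a_priori k i :
  cabs (Z z k ord0 i - xi ord0 i) <=
  theta z ^+ k * lambda z ^+ (2 ^ k - 1) / (1 - theta z * lambda z ^+ (2 ^ k)) *
  cabs (W z ord0 i).
Proof.
have [_ gz lz] := iz; have l0 := lambda_ge0 iz.
rewrite mulrAC.
have k0 : (0 < 2 ^ k)%N by rewrite expn_gt0.
have A0 : 0 <= theta z ^+ k * lambda z ^+ (2 ^ k - 1) * cabs (W z ord0 i).
  by rewrite !mulr_ge0 ?exprn_ge0 ?cabs_ge0 ?(ltW gz).
have := @ccvg_geometric_error _ (fun m => Z z (k + m) ord0 i) (xi ord0 i) _ _
  A0 (rate_range iz k0) _ (ccvg_shift k (Zxi i)).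
by rewrite /= addn0; apply=> m; rewrite addnS; exact: seq_step_le.
Qed.

(** Weakening the double exponential to a single geometric rate, the same for all
    [k], makes the convergence to zero immediate. *)
Lemma weierstrass_linear_error k i :
  cabs (Z z k ord0 i - xi ord0 i) <=
  (theta z * lambda z) ^+ k / (1 - theta z * lambda z) * cabs (W z ord0 i).
Proof.
have [_ gz lz] := iz; have l0 := lambda_ge0 iz.
have /andP[r0 r1] := rate_range iz (ltn0Sn 0); rewrite expr1 in r0 r1.
apply: le_trans (weierstrass_a_priori k i) _; rewrite ler_wpM2r ?cabs_ge0 //.
have k0 : (0 < 2 ^ k)%N by rewrite expn_gt0.
have /andP[_ rk] := rate_range iz k0.
rewrite ler_pM ?mulr_ge0 ?invr_ge0 ?exprn_ge0 ?(ltW gz) ?subr_ge0 //.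
- by rewrite ltW.
- rewrite (exprMn k (theta z)) ler_wpM2l ?exprn_ge0 ?(ltW gz) // ler_wiXn2l //.
  by rewrite leq_subRL ?expn_gt0 // add1n ltn_expl.
rewrite lef_pV2 ?posrE ?subr_gt0 // lerB // ler_wpM2l ?(ltW gz) //.
by rewrite -[leRHS]expr1 ler_wiXn2l // expn_gt0.
Qed.

End Limit.

(** The a posteriori estimate is the a priori one for the sequence restarted at
    the [k]-th iterate. *)
Lemma weierstrass_a_posteriori z xi k i : initial_condition z ->
  (forall i, ccvg (fun k => Z z k ord0 i) (xi ord0 i)) ->
  cabs (Z z k.+1 ord0 i - xi ord0 i) <=
  theta (Z z k) * lambda (Z z k) /
  (1 - theta (Z z k) * lambda (Z z k) ^+ 2) * cabs (W (Z z k) ord0 i).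
Proof.
move=> iz Zxi; have ik := initial_condition_seq k iz.
have Zkxi j : ccvg (fun m => Z (Z z k) m ord0 j) (xi ord0 j).
  under [X in ccvg X]eq_fun do rewrite weierstrass_seqD.
  exact: (ccvg_shift k (Zxi j)).
by have := weierstrass_a_priori ik Zkxi 1 i; rewrite weierstrass_seqD addn1 !expr1.
Qed.

(** Near a limit with distinct coordinates the distances between coordinates stay
    away from zero, so that both [W] and [E] are at most of the order of the error.
    As [correction_factor] is at most of the order of [E], the a posteriori
    estimate becomes quadratic in the error. *)
Lemma weierstrass_quadratic z xi : initial_condition z -> distinct_coords xi ->
  (forall i, ccvg (fun k => Z z k ord0 i) (xi ord0 i)) ->
  exists C, forall k,
    pnorm p (Z z k.+1 - xi) <= C * pnorm p (Z z k - xi) ^+ 2.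
Proof.
move=> iz dxi Zxi; have [_ gz lz] := iz; have l0 := lambda_ge0 iz.
have [D D0 errD] : exists2 D, 0 <= D & forall i k, cabs (Z z k ord0 i - xi ord0 i) <= D.
  by apply: cvg_uniform_bound => i; apply/cvg_ex; exists 0; exact: Zxi.
have [B B0 gapB] : exists2 B, 0 <= B & forall (ij : 'I_n * 'I_n) k,
    (cabs (Z z k ord0 ij.1 - Z z k ord0 ij.2))^-1 <= B.
  (* On the diagonal the inverse distance is 0^-1 = 0. *)
  apply: cvg_uniform_bound => -[i j] /=; have [->|ij] := eqVneq i j.
    under eq_fun do rewrite subrr cabs0 invr0.
    exact: is_cvg_cst.
  apply/cvg_ex; exists (cabs (xi ord0 i - xi ord0 j))^-1; apply: cvgV.
    by rewrite gt_eqF // cabs_gt0 subr_eq0; apply: contra_neq ij => /dxi.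
  exact: ccvg_cabs (ccvgB (Zxi i) (Zxi j)).
(* Each factor |z_i - xi_j| / |z_i - z_j| is at most 1 + |z_j - xi_j| / |z_i - z_j|. *)
pose M := (1 + D * B) ^+ n.-1.
have DB0 : 0 <= 1 + D * B by rewrite addr_ge0 // mulr_ge0.
have M0 : 0 <= M by exact: exprn_ge0.
have W_le k i : cabs (W (Z z k) ord0 i) <= M * cabs (Z z k ord0 i - xi ord0 i).
  have [dk _ _] := initial_condition_seq k iz.
  have dist_gt0 j : j != i -> 0 < cabs (Z z k ord0 i - Z z k ord0 j).
    by move=> ji; rewrite cabs_gt0 subr_eq0; apply: contra_neq ji => /dk.
  rewrite mxE {1}(weierstrass_limit_factorization iz Zxi) horner_prodXsubC.
  rewrite (bigD1 i) //= -mulrA -prodf_div cabsM mulrC ler_wpM2r ?cabs_ge0 //.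
  rewrite cabs_prod /M.
  have <- : \prod_(j | j != i) (1 + D * B) = (1 + D * B) ^+ n.-1.
    by rewrite prodr_const cardC1 card_ord.
  apply: ler_prod => j ji; rewrite cabs_ge0 /= cabsM cabsV ler_pdivrMr ?dist_gt0 //.
  have -> : Z z k ord0 i - xi ord0 j = (Z z k ord0 i - Z z k ord0 j) +
    (Z z k ord0 j - xi ord0 j) by ring.
  apply: le_trans (cabsD _ _) _; rewrite mulrDl mul1r lerD2l -mulrA.
  apply: le_trans (errD j k) _; rewrite ler_peMr //.
  by rewrite -ler_pdivrMr ?dist_gt0 // mul1r (gapB (i, j)).
have E_le k : E (Z z k) <= B * M * pnorm p (Z z k - xi).
  apply: pnorm_le => // [|i]; first exact: mulr_ge0.
  have [j ji dj] := min_dist_attained (Z z k) i n2.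
  rewrite mxE [X in _ <= _ * cabs X]mxE [X in _ <= _ * cabs (_ + X)]mxE.
  rewrite cabsM cabsV cabs_real; last by rewrite dj cabs_ge0.
  rewrite mulrC -mulrA ler_pM ?invr_ge0 ?cabs_ge0 //; first by rewrite dj cabs_ge0.
  by rewrite dj (gapB (i, j)).
have /andP[r0 r1] := rate_range iz (ltn0Sn 0); rewrite expr1 in r0 r1.
(* If E z = 0 then L = 0, which is right because E and lambda then vanish at every
   iterate. *)
pose L := theta z * lambda z / E z / (1 - theta z * lambda z).
have L0 : 0 <= L by apply: divr_ge0; [exact: divr_ge0 | rewrite subr_ge0 ltW].
have K_le k : theta (Z z k) * lambda (Z z k) /
    (1 - theta (Z z k) * lambda (Z z k) ^+ 2) <= L * E (Z z k).
  have ik := initial_condition_seq k iz; have [_ gk lk] := ik.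
  have lk0 := lambda_ge0 ik.
  have Ek : E (Z z k) <= E z.
    apply: le_trans (Wd_norm_seq k iz) _.
    by rewrite ler_piMl // exprn_ile1.
  have rk : theta (Z z k) * lambda (Z z k) <= theta z * lambda z / E z * E (Z z k).
    rewrite -!correction_factorE // mulrAC -mulrA mulrC.
    apply: (correction_factor_scale n2 hp hpq) => //.
      have := E_ge0 z; rewrite le_eqVlt => /predU1P[<-|E0].
        by rewrite invr0 mulr0 lexx ler01.
      by rewrite divr_ge0 //= ler_pdivrMr // mul1r.
    have := E_ge0 z; rewrite le_eqVlt => /predU1P[E0|E0].
      by rewrite -E0 mulr0 E0.
    by rewrite divfK // gt_eqF.
  have rk1 : theta (Z z k) * lambda (Z z k) <= theta z * lambda z.
    rewrite -!correction_factorE // -[leRHS]mul1r.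
    by apply: (correction_factor_scale n2 hp hpq); rewrite ?ler01 ?lexx ?mul1r.
  have /andP[_ rk2] := rate_range ik (ltn0Sn 1).
  rewrite /L [leRHS]mulrAC ler_pM ?invr_ge0 ?subr_ge0 ?(ltW rk2) //.
    by rewrite mulr_ge0 // ltW.
  rewrite lef_pV2 ?posrE ?subr_gt0 // lerB //.
  apply: le_trans rk1; rewrite ler_wpM2l ?(ltW gk) // expr2 ler_piMr //.
exists (L * M * (B * M)) => k.
apply: le_trans (_ : _ <= L * E (Z z k) * M * pnorm p (Z z k - xi)) _.
  apply: pnorm_le => // [|i]; first by apply: mulr_ge0 => //; exact: mulr_ge0.
  rewrite mxE [X in cabs (_ + X)]mxE.
  rewrite [X in _ <= _ * cabs X]mxE [X in _ <= _ * cabs (_ + X)]mxE.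
  apply: le_trans (weierstrass_a_posteriori k i iz Zxi) _.
  rewrite -[leRHS]mulrA; have ik := initial_condition_seq k iz; have [_ gk _] := ik.
  have /andP[_ rk2] := rate_range ik (ltn0Sn 1).
  rewrite ler_pM ?cabs_ge0 //.
  by rewrite divr_ge0 ?subr_ge0 ?(ltW rk2) // mulr_ge0 ?lambda_ge0 // ltW.
set e := pnorm p (Z z k - xi); have e0 : 0 <= e by exact: pnorm_ge0.
have -> : L * E (Z z k) * M * e = L * M * e * E (Z z k) by ring.
have -> : L * M * (B * M) * e ^+ 2 = L * M * e * (B * M * e) by ring.
by rewrite ler_wpM2l ?E_le // mulr_ge0 // mulr_ge0.
Qed.

End Iteration.

Theorem theorem1 (R : realType) (n : nat) (f : {poly R[i]}) (p q : \bar R)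
    (z0 : 'rV[R[i]]_n)
    (hn : (2 <= n)%N)
    (f_monic : f \is monic)
    (f_deg : size f = n.+1)
    (f_simple : simple_zeros f)
    (hp : (1 <= p)%E)
    (hpq : (p^-1 + q^-1 = 1)%E)
    (z0_distinct : distinct_coords z0)
    (hE : Wd_norm p f z0 < 1 / 2 `^ inv_exp q)
    (hphi : phi n p q (Wd_norm p f z0) <= 1) :
  let z := weierstrass_seq f z0 in
  let E := fun k => Wd_norm p f (z k) in
  let lambda := fun k => phi n p q (E k) in
  let theta := fun k => 1 - 2 `^ inv_exp q * E k in
  (forall k : nat, distinct_coords (z k)) /\
  exists xi : 'rV[R[i]]_n,
    [/\ root_vector f xi,
        converges_to p z xi,
        lambda 0%N < 1 -> converges_quadratically p z xi,
        forall k : nat, (1 <= k)%N ->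
          pnorm p (z k - xi) <=
            theta 0%N ^+ k * lambda 0%N ^+ (2 ^ k - 1) /
            (1 - theta 0%N * lambda 0%N ^+ (2 ^ k)) * pnorm p (z 1%N - z 0%N)
      & forall k : nat,
          pnorm p (z k.+1 - xi) <=
            theta k * lambda k / (1 - theta k * lambda k ^+ 2) *
            pnorm p (z k.+1 - z k)].
Proof.
move=> z E lambda theta.
have i0 : initial_condition f p q z0.
  split => //; rewrite subr_gt0 mulrC -ltr_pdivlMr // powR_gt0 //.
have ik k : initial_condition f p q (z k) by exact: initial_condition_seq.
have E0 k : 0 <= E k by exact: pnorm_ge0.
have l0 k : 0 <= lambda k by case: (ik k) => *; exact: phi_ge0.
have t0 k : 0 < theta k by case: (ik k).
split=> [k|]; first by case: (ik k).
have [xi Zxi] := weierstrass_seq_ccvg hn f_monic f_deg hp hpq i0.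
have fxi := weierstrass_limit_factorization hn f_monic f_deg hp hpq i0 Zxi.
have dxi : distinct_coords xi by apply: simple_zeros_distinct; rewrite -fxi.
have coord k i : (z k - xi) ord0 i = z k ord0 i - xi ord0 i by rewrite !mxE.
have stepE k i : cabs ((z k.+1 - z k) ord0 i) = cabs (weierstrass f (z k) ord0 i).
  have -> : (z k.+1 - z k) ord0 i = z k.+1 ord0 i - z k ord0 i by rewrite !mxE.
  by rewrite weierstrass_seqS cabsN.
have cvg_xi : converges_to p z xi.
  pose r := theta 0%N * lambda 0%N.
  have : 0 <= r < 1 by have := rate_range hp hpq i0 (ltn0Sn 0); rewrite expr1.
  move=> /andP[r0 r1].
  have rk : r ^+ k * ((1 - r)^-1 * pnorm p (z 1%N - z 0%N)) @[k --> \oo] --> (0 : R).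
    rewrite -[X in _ --> X](mul0r ((1 - r)^-1 * pnorm p (z 1%N - z 0%N))).
    apply: cvgM; last exact: cvg_cst.
    by apply: cvg_expr; rewrite ger0_norm.
  apply: (cvg0_le rk) => k; rewrite pnorm_ge0 mulrA andTb.
  apply: pnorm_le => // [|i]; first by rewrite divr_ge0 ?exprn_ge0 // subr_ge0 ltW.
  by rewrite coord stepE; exact: weierstrass_linear_error.
exists xi; split => //.
- by split=> // i; rewrite fxi rootE horner_prodXsubC (bigD1 i) //= subrr mul0r.
- by move=> _; split=> //; exact: (weierstrass_quadratic hn f_monic f_deg hp hpq i0).
- move=> k _; have k0 : (0 < 2 ^ k)%N by rewrite expn_gt0.
  have /andP[_ rk] := rate_range hp hpq i0 k0.
  apply: pnorm_le => // [|i].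
    apply: divr_ge0; last by rewrite subr_ge0 ltW.
    by rewrite mulr_ge0 // exprn_ge0 // ltW.
  by rewrite coord stepE; exact: weierstrass_a_priori.
move=> k; have /andP[_ rk] := rate_range hp hpq (ik k) (ltn0Sn 1).
apply: pnorm_le => // [|i].
  apply: divr_ge0; last by rewrite subr_ge0 ltW.
  by rewrite mulr_ge0 // ltW.
by rewrite coord stepE; exact: (weierstrass_a_posteriori hn f_monic f_deg hp hpq).
Qed.
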